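(* Let $d\ge 1$, let $\mathbb{Z}^d$ be equipped with a connection $\mathcal{C}$ satisfying conditions (C1)–(C3) of the context, and let $n\in\mathbb{N}$. For every $f\in\mathcal{A}(\mathbb{Z}^d)$ the functions $(L_n\circ U_n)(f)$ and $(U_n\circ L_n)(f)$ have neither local maximum sets nor local minimum sets of size $n$ or less. Furthermore, $$(L_n\circ U_n)(f)=(U_n\circ L_n)(f)=f$$ if and only if $f$ does not have local maximum sets or local minimum sets of size less than or equal to $n$.
   Context: $\mathbb{N}=\{1,2,\dots\}$. $\mathcal{A}(\mathbb{Z}^d)$ is the set of all functions $f:\mathbb{Z}^d\to\mathbb{R}$. The size of a set is its cardinality $\mathrm{card}$. A connection on a non-empty set $B$ is a family $\mathcal{C}$ of subsets of $B$ such that (i) $\emptyset\in\mathcal{C}$; (ii) $\{x\}\in\mathcal{C}$ for all $x\in B$; (iii) for any family $\{C_i:i\in I\}\subseteq\mathcal{C}$, $\bigcap_{i\in I} C_i\neq\emptyset$ implies $\bigcup_{i\in I} C_i\in\mathcal{C}$. Members of $\mathcal{C}$ are called connected sets. Standing assumptions on the connection $\mathcal{C}$ on $\mathbb{Z}^d$: (C1) $\mathbb{Z}^d\in\mathcal{C}$; (C2) for every $C\in\mathcal{C}$ and $a\in\mathbb{Z}^d$, the translate $\{x+a:x\in C\}$ is in $\mathcal{C}$; (C3) if $V\subsetneq W$ with $V,W\in\mathcal{C}$, then there exists $x\in W\setminus V$ with $V\cup\{x\}\in\mathcal{C}$. For $x\in\mathbb{Z}^d$ and $n\in\mathbb{N}$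 let $\mathcal{N}_n(x)=\{V\in\mathcal{C}: x\in V,\ \mathrm{card}(V)=n+1\}$. For $f\in\mathcal{A}(\mathbb{Z}^d)$: $$L_n(f)(x)=\max_{V\in\mathcal{N}_n(x)}\min_{y\in V}f(y),\qquad U_n(f)(x)=\min_{V\in\mathcal{N}_n(x)}\max_{y\in V}f(y).$$ For $V\in\mathcal{C}$ let $\mathrm{adj}(V)=\{x\in\mathbb{Z}^d\setminus V: V\cup\{x\}\in\mathcal{C}\}$. A non-empty connected set $V$ is a local maximum set of $f$ if $\max_{y\in\mathrm{adj}(V)}f(y)<\min_{x\in V}f(x)$, and a local minimum set of $f$ if $\min_{y\in\mathrm{adj}(V)}f(y)>\max_{x\in V}f(x)$. *)

(* Defs.v *)
(* MathComp-Analysis *)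
From HB Require Import structures.
From mathcomp Require Import all_boot all_order all_algebra.
From mathcomp Require Import all_classical all_reals ereal.

Set Implicit Arguments.
Unset Strict Implicit.
Unset Printing Implicit Defensive.

Import Order.TTheory GRing.Theory Num.Theory.

Local Open Scope classical_set_scope.
Local Open Scope card_scope.
Local Open Scope ring_scope.

Record connection (B : Type) (C : set (set B)) : Prop := Connection {
  connection_set0 : C set0;
  connection_set1 : forall x : B, C [set x];
  connection_bigcup : forall (I : Type) (A : I -> set B),
    (forall i, C (A i)) -> \bigcap_i A i !=set0 -> C (\bigcup_i A i)
}.

Definition translation_invariant (V : zmodType) (C : set (set V)) : Prop :=
  forall (A : set V) (a : V), C A -> C [set x + a | x in A].

Definition pointwise_extendable (B : Type) (C : set (set B)) : Prop :=
  forall V W : set B, C V -> C W -> V `<` W ->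
    exists x, (W `\` V) x /\ C (V `|` [set x]).

Definition nbhd (B : Type) (C : set (set B)) (n : nat) (x : B) : set (set B) :=
  [set V | [/\ C V, V x & V #= `I_n.+1]].

(* A family [nbhd C n x] may be infinite, so its "max" and "min" are a real
   [sup] and [inf]. These are meaningful values: for a set [V] of the family,
   [inf (f @` V)] is the minimum of finitely many values and is at most [f x],
   and dually; on an infinite [B], the family is non-empty as soon as [setT] is
   connected and [pointwise_extendable C] holds. *)
Definition opL (R : realType) (B : Type) (C : set (set B)) (n : nat)
    (f : B -> R) : B -> R :=
  fun x => sup [set inf (f @` V) | V in nbhd C n x].

Definition opU (R : realType) (B : Type) (C : set (set B)) (n : nat)
    (f : B -> R) : B -> R :=
  fun x => inf [set sup (f @` V) | V in nbhd C n x].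

Definition adj (B : Type) (C : set (set B)) (V : set B) : set B :=
  [set x | ~ V x /\ C (V `|` [set x])].

(* The bounds are taken in [\bar R] because [f] may be unbounded on [adj C V]. *)
Definition local_max_set (R : realType) (B : Type) (C : set (set B))
    (f : B -> R) (V : set B) : Prop :=
  [/\ V !=set0, C V &
    (ereal_sup [set (f y)%:E | y in adj C V]
      < ereal_inf [set (f x)%:E | x in V])%E].

Definition local_min_set (R : realType) (B : Type) (C : set (set B))
    (f : B -> R) (V : set B) : Prop :=
  [/\ V !=set0, C V &
    (ereal_inf [set (f y)%:E | y in adj C V]
      > ereal_sup [set (f x)%:E | x in V])%E].

Definition no_small_local_sets (R : realType) (B : Type) (C : set (set B))
    (n : nat) (f : B -> R) : Prop :=
  forall V : set B, V #<= `I_n ->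
    ~ local_max_set C f V /\ ~ local_min_set C f V.

(* Main.v *)
(** A connected set of size [n + 1] that meets a set [V] of size at most [n]
    contains a point of [adj C V].  Hence [opL C n f] has no local maximum set
    of size at most [n], and, growing [n + 1]-point connected sets one point at
    a time inside the connected component of [x] in [f > c], a function without
    such local maximum sets is fixed by [opL C n].  Moreover [opL C n] creates
    no local minimum set of size at most [n].  The statements about [opU] follow
    by passing to [- f], and the theorem by composing the two operators. *)
Require Import Defs.
From HB Require Import structures.
From mathcomp Require Import all_boot all_order all_algebra.
From mathcomp Require Import all_classical all_reals ereal.
From mathcomp Require Import lra.

Set Implicit Arguments.
Unset Strict Implicit.
Unset Printing Implicit Defensive.

Import Order.TTheory GRing.Theory Num.Theory.

Local Open Scope classical_set_scope.
Local Open Scope ring_scope.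

(** * Connected components and growth of connected sets *)

Section Connectivity.
Context {B : Type} {C : set (set B)}.
Hypothesis hC : connection C.

Lemma connectionU (V W : set B) (x : B) :
  C V -> C W -> V x -> W x -> C (V `|` W).
Proof.
move=> CV CW Vx Wx.
(* [bigcup2 V W] has empty terms past index 1, so its intersection is empty; indexing by [bool]
   keeps [x] in every term. *)
rewrite -bigcup2E.
have -> : \bigcup_i bigcup2 V W i =
    \bigcup_(b in [set: bool]) (if b then V else W).
  rewrite bigcup2E; apply/seteqP; split => [y [Vy|Wy]|y [[] _ /= hy]].
  - by exists true.
  - by exists false.
  - by left.
  - by right.
apply: (connection_bigcup hC) => [[]//|].
by exists x => -[].
Qed.

(** [K] is the union of all connected subsets of [P] through [x]. A point of [adj C K] in [P] would
    enlarge [K] to another such subset, hence already lie in [K]. *)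
Lemma connected_component_in (P : set B) (x : B) : P x ->
  exists K, [/\ C K, K x, K `<=` P & adj C K `<=` ~` P].
Proof.
move=> Px.
pose F := {W : set B | [/\ C W, W x & W `<=` P]}.
pose K := \bigcup_(W in [set: F]) sval W.
have Fx : [/\ C [set x], [set x] x & [set x] `<=` P].
  by split=> //; [exact: (connection_set1 hC)|move=> _ ->].
have CK : C K.
  apply: (connection_bigcup hC); first by case=> W [].
  by exists x; case=> W [].
have Kx : K x by exists (exist _ [set x] Fx).
have KP : K `<=` P by move=> y [[W [_ _ WP]] _ /= /WP].
exists K; split=> // y [nKy CKy] Py; apply: nKy.
have FKy : [/\ C (K `|` [set y]), (K `|` [set y]) x & K `|` [set y] `<=` P].
  by split=> //; [left|move=> z [/KP//|->]].
exists (exist (fun W => [/\ C W, W x & W `<=` P]) _ FKy) => //.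
by right.
Qed.

Hypothesis hC3 : pointwise_extendable C.

(** Extending [V] inside the connected set [V] joined with [W] adds a point that can only come from
    [W]. *)
Lemma adj_meets (V W : set B) (x : B) :
  C V -> C W -> V x -> W x -> ~ W `<=` V -> exists2 y, W y & adj C V y.
Proof.
move=> CV CW Vx Wx nWV.
have VVW : V `<` V `|` W.
  by split=> [|VW]; [move=> y; left|apply: nWV => y Wy; apply: VW; right].
have [y [[[//|Wy] nVy] CVy]] := hC3 CV (connectionU CV CW Vx Wx) VVW.
by exists y.
Qed.

Lemma card_not_subset (V W : set B) n :
  (V #<= `I_n)%card -> (W #= `I_n.+1)%card -> ~ W `<=` V.
Proof.
move=> Vn Wn /subset_card_le WV; have := card_le_trans WV Vn.
by rewrite (card_le_eql Wn) card_le_II ltnn.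
Qed.

Lemma nbhd_subset (n : nat) (x : B) (W : set B) :
  C W -> W x -> ~ (W #<= `I_n)%card -> exists2 V, nbhd C n x V & V `<=` W.
Proof.
move=> CW Wx; elim: n => [|n IH] Wn.
  exists [set x]; last by move=> _ ->.
  by split=> //; [exact: (connection_set1 hC)|exact: card_set1].
have [|V [CV Vx Vn] VW] := IH.
  by move=> Wn'; apply: Wn; apply: card_le_trans Wn' _; rewrite card_le_II.
have [|y [[Wy nVy] CVy]] := hC3 CV CW _.
  split=> // WV; apply: Wn; apply: (card_le_trans (subset_card_le WV)).
  by rewrite (card_le_eql Vn).
exists (V `|` [set y]); last by move=> z [/VW//|->].
split; [exact: CVy|by left|].
apply/eq_cardSP; exists y; first by right.
suff -> : (V `|` [set y]) `\ y = V by [].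
apply/seteqP; split=> z; first by case=> -[].
by move=> Vz; split; [left|move=> zy; apply: nVy; rewrite -zy].
Qed.

End Connectivity.

(** * Minima over finite sets *)

Section FiniteExtrema.
Context {R : realType} {B : Type}.

Lemma finite_set_min (f : B -> R) (V : set B) :
  finite_set V -> V !=set0 -> exists2 x, V x & forall y, V y -> f x <= f y.
Proof.
move=> /finite_setP[n]; elim: n V => [V|n IH V].
  by rewrite II0 card_eq0 => /eqP -> [].
move=> /eq_cardSP[x Vx /IH{}IH] _.
have [V0|/set0P/IH[y [Vy _] fy]] := eqVneq (V `\ x) set0.
  exists x => // z Vz; have [->//|zx] := pselect (z = x).
  by suff : (V `\ x) z by rewrite V0.
have fz z : V z -> z <> x -> f y <= f z by move=> Vz zx; exact: fy.
have [fxy|/ltW fyx] := leP (f x) (f y).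
  exists x => // z Vz; have [->//|zx] := pselect (z = x).
  exact: le_trans fxy (fz _ Vz zx).
by exists y => // z Vz; have [->//|/(fz _ Vz)] := pselect (z = x).
Qed.

Lemma has_lbound_finite_image (f : B -> R) (V : set B) :
  finite_set V -> has_lbound (f @` V).
Proof.
move=> finV; have [->|/set0P/(finite_set_min f finV)[x _ fx]] := eqVneq V set0.
  by exists 0 => _ [y []].
by exists (f x) => _ [y Vy <-]; exact: fx.
Qed.

Lemma finite_nbhd (C : set (set B)) n x V : nbhd C n x V -> finite_set V.
Proof. by case=> _ _ Vn; apply/finite_setP; exists n.+1. Qed.

End FiniteExtrema.

(** * Bounds for [opL], duality with [opU], and real thresholds *)

Section Opening.
Context {R : realType} {B : Type} {C : set (set B)}.
Implicit Types (f : B -> R) (V : set B).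

Lemma inf_nbhd_le f n x V : nbhd C n x V -> inf (f @` V) <= f x.
Proof.
move=> NV; apply: ge_inf; last by case: NV => _ Vx _; exists x.
exact/has_lbound_finite_image/(finite_nbhd NV).
Qed.

Lemma le_opL f n x V c :
  nbhd C n x V -> (forall y, V y -> c <= f y) -> c <= opL C n f x.
Proof.
move=> NV cV; apply: (@le_trans _ _ (inf (f @` V))).
  apply: lb_le_inf; first by exists (f x), x => //; case: NV.
  by move=> _ [y Vy <-]; exact: cV.
apply: ub_le_sup; last by exists V.
(* The family has a genuine supremum: each of its sets contains [x], so [f x] bounds all the
   minima. *)
by exists (f x) => _ [W NW <-]; exact: inf_nbhd_le NW.
Qed.

Lemma lt_opL f n x c : nbhd C n x !=set0 -> c < opL C n f x ->
  exists2 V, nbhd C n x V & forall y, V y -> c < f y.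
Proof.
move=> [V0 NV0] /sup_gt[|_ [V NV <-] cV]; first by exists (inf (f @` V0)), V0.
exists V => // y Vy; apply: (lt_le_trans cV); apply: ge_inf; last by exists y.
exact/has_lbound_finite_image/(finite_nbhd NV).
Qed.

Lemma opL_le f n x : nbhd C n x !=set0 -> opL C n f x <= f x.
Proof.
move=> [V0 NV0]; apply: ge_sup; first by exists (inf (f @` V0)), V0.
by move=> _ [V NV <-]; exact: inf_nbhd_le NV.
Qed.

Lemma opUN f n : opU C n f = \- opL C n (\- f).
Proof.
apply/funext => x; rewrite /opU /opL {1}/inf /=; congr (- sup _).
have supN V : - sup (f @` V) = inf [set - f y | y in V].
  rewrite /inf; congr (- sup _); apply/seteqP; split=> [_ [y Vy <-]|_ [_ [y Vy <-] <-]].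
    by exists (- f y); [exists y|rewrite opprK].
  by exists y; rewrite ?opprK.
apply/seteqP; split=> [_ [_ [V NV <-] <-]|_ [V NV <-]].
  by exists V; rewrite ?supN.
by exists (sup (f @` V)); [exists V|rewrite supN].
Qed.

Lemma opLN f n : opL C n f = \- opU C n (\- f).
Proof.
rewrite opUN; apply/funext=> x /=; rewrite opprK; congr (opL _ _ _ _).
by apply/funext=> y /=; rewrite opprK.
Qed.

Lemma local_min_setN f V : local_min_set C f V <-> local_max_set C (\- f) V.
Proof.
have N (A : set B) : [set (- f y)%:E | y in A] = (-%E @` [set (f y)%:E | y in A])%E.
  by rewrite image_comp; apply: eq_imagel.
rewrite /local_min_set /local_max_set !N ereal_supN ereal_infN lteN2.
by [].
Qed.

(** A real threshold replaces the comparison of extended bounds. *)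
Lemma local_max_set_gt f V : local_max_set C f V ->
  exists2 t, forall x, V x -> t < f x & forall y, adj C V y -> f y < t.
Proof.
move=> [[x Vx] CV].
have supP y : adj C V y -> ((f y)%:E <= ereal_sup [set (f y)%:E | y in adj C V])%E.
  by move=> Ay; apply: ereal_sup_ubound; exists y.
have infP y : V y -> (ereal_inf [set (f x)%:E | x in V] <= (f y)%:E)%E.
  by move=> Vy; apply: ereal_inf_lbound; exists y.
have := infP x Vx.
move: (ereal_inf _) (ereal_sup _) infP supP => [b| |] [a| |]//= bV aA _ ab.
- exists ((a + b) / 2) => [y /bV|y /aA]; rewrite lee_fin; move: ab;
  rewrite lte_fin; lra.
(* The supremum is [-oo], so [adj C V] is empty and any number below [b] will do. *)
- exists (b - 1) => [y /bV|y /aA]; rewrite ?lee_fin //; lra.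
Qed.

(** A weak bound on [adj C V] suffices, because the minimum over the finite set [V] is attained and
    so exceeds [t]. *)
Lemma gt_local_max_set f V t : finite_set V -> V !=set0 -> C V ->
  (forall x, V x -> t < f x) -> (forall y, adj C V y -> f y <= t) ->
  local_max_set C f V.
Proof.
move=> finV V0 CV tV At; split=> //.
have [x Vx fx] := finite_set_min f finV V0.
apply: (@le_lt_trans _ _ t%:E).
  by apply: ge_ereal_sup => _ [y Ay <-]; rewrite lee_fin; exact: At.
apply: (@lt_le_trans _ _ (f x)%:E); first by rewrite lte_fin; exact: tV.
by apply: le_ereal_inf_tmp => _ [y Vy <-]; rewrite lee_fin; exact: fx.
Qed.

(** One half of [no_small_local_sets]; the other half is the same property of [\- f]. *)
Definition no_small_max (n : nat) (f : B -> R) : Prop :=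
  forall V : set B, (V #<= `I_n)%card -> ~ local_max_set C f V.

Hypothesis hC : connection C.
Hypothesis hC1 : C setT.
Hypothesis hC3 : pointwise_extendable C.
Hypothesis infB : infinite_set [set: B].

Lemma infinite_not_card_le n : ~ ([set: B] #<= `I_n)%card.
Proof. by move=> Bn; apply: infB; apply/finite_set_leP; exists n. Qed.

(** The whole space is connected and infinite, so a neighbourhood can be grown inside it. *)
Lemma nbhd_neq0 n x : nbhd C n x !=set0.
Proof.
have [//|V NV _] := nbhd_subset hC hC3 (n := n) hC1 (I : setT x).
  exact: infinite_not_card_le.
by exists V.
Qed.

Lemma opL_no_small_max n f : no_small_max n (opL C n f).
Proof.
move=> V Vn mV; have [t tV At] := local_max_set_gt mV.
case: mV => -[x Vx] CV _.
have [W [CW Wx Wn] tW] := lt_opL (nbhd_neq0 n x) (tV _ Vx).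
have [y Wy /At] := adj_meets hC hC3 CV CW Vx Wx (card_not_subset Vn Wn).
(* [W] is a neighbourhood of [y] as well as of [x], so [opL C n f y] is at least [t]. *)
rewrite ltNge => /negP; apply; apply: (@le_opL _ _ _ W) => //.
by move=> z /tW/ltW.
Qed.

Lemma opL_id n f : no_small_max n f -> opL C n f = f.
Proof.
move=> nf; apply/funext=> x; apply/eqP; rewrite eq_le (opL_le _ (nbhd_neq0 n x)) leNgt.
apply/negP => Lf.
pose c := (opL C n f x + f x) / 2.
have Lc : opL C n f x < c by rewrite /c; lra.
have [|K [CK Kx Kc Ac]] := @connected_component_in _ _ hC [set y | c < f y] x.
  by rewrite /= /c; lra.
(* A small [K] is a forbidden local maximum set; a larger one contains a neighbourhood of [x] on
   which [f > c], against the choice of [c]. *)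
have [Kn|Kn] := pselect (K #<= `I_n)%card.
  apply: (nf _ Kn); apply: (@gt_local_max_set _ _ c) => //.
  - by apply/finite_set_leP; exists n.
  - by exists x.
  - by move=> y /Ac /= /negP; rewrite -leNgt.
have [W NW WK] := nbhd_subset hC hC3 CK Kx Kn.
move: Lc; rewrite ltNge => /negP; apply; apply: (le_opL NW) => y /WK/Kc.
exact: ltW.
Qed.

Lemma opL_no_small_min n f :
  no_small_max n (\- f) -> no_small_max n (\- opL C n f).
Proof.
(* Let [t] separate [opL C n f] on a small local minimum set [V] from its
   values on [adj C V]. If [f z < t] for some [z] in [V], the component of [z]
   in [f < t] stays in [V] and is a local minimum set of [f]. Otherwise [V],
   joined to a neighbourhood of an adjacent point where [f > t], forces
   [opL C n f >= t] on [V]. *)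
move=> nf V Vn mV; have [s sV As] := local_max_set_gt mV.
pose t := - s.
have tV y : V y -> opL C n f y < t by move=> /sV /=; rewrite /t; lra.
have {As} At y : adj C V y -> t < opL C n f y by move=> /As /=; rewrite /t; lra.
case: mV => -[x Vx] CV _.
have [[z Vz fz]|Vt] := pselect (exists2 z, V z & f z < t).
  have [//|K [CK Kz Kt AK]] := @connected_component_in _ _ hC [set y | f y < t] z.
  (* At a point of [K] adjacent to [V], [opL C n f <= f < t] would contradict [At]. *)
  have KV : K `<=` V.
    apply: contrapT => /(adj_meets hC hC3 CV CK Vz Kz)[y /Kt /= fy /At].
    by rewrite ltNge (le_trans (opL_le _ (nbhd_neq0 _ _)) (ltW fy)).
  have Kn := card_le_trans (subset_card_le KV) Vn.
  apply: (nf _ Kn); apply: (@gt_local_max_set _ _ (- t)) => //.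
  - by apply/finite_set_leP; exists n.
  - by exists z.
  - by move=> y /Kt /=; rewrite ltrN2.
  - by move=> y /AK /= /negP; rewrite -leNgt lerN2.
have nTV : ~ [set: B] `<=` V.
  move=> TV; apply: (@infinite_not_card_le n).
  exact: card_le_trans (subset_card_le TV) Vn.
have [y _ Ay] := adj_meets hC hC3 CV hC1 Vx I nTV.
have [W [CW Wy Wn] tW] := lt_opL (nbhd_neq0 n y) (At _ Ay).
(* [W] need not meet [V]; the point [y], which is in [W] and adjacent to [V], links them. *)
have CVW : C (V `|` W).
  suff -> : V `|` W = (V `|` [set y]) `|` W.
    by apply: (@connectionU _ _ hC _ _ y) => //; [case: Ay|right].
  by rewrite -setUA; congr (_ `|` _); apply/esym/setUidr => _ ->.
have VWn : ~ (V `|` W #<= `I_n)%card.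
  by move=> /card_not_subset/(_ Wn); apply=> z; right.
have [U NU UVW] := nbhd_subset hC hC3 CVW (or_introl Vx : (V `|` W) x) VWn.
have := tV _ Vx; rewrite ltNge => /negP; apply.
apply: (le_opL NU) => z /UVW[Vz|/tW/ltW//].
by rewrite leNgt; apply/negP => fz; apply: Vt; exists z.
Qed.

Lemma no_small_local_setsE n f :
  no_small_local_sets C n f <-> no_small_max n f /\ no_small_max n (\- f).
Proof.
split=> [nf|[nf nNf] V Vn].
  by split=> V /nf[] // _ nV /local_min_setN.
by split; [exact: nf|move=> /local_min_setN; exact: nNf].
Qed.

Lemma oppfK f : \- (\- f) = f.
Proof. by apply/funext => x /=; rewrite opprK. Qed.

(** By duality [\- opU C n f] is [opL C n (\- f)], which has no small local maximum set; this is
    what [opL_no_small_min] requires of [opU C n f]. *)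
Lemma opLU_no_small n f : no_small_local_sets C n (opL C n (opU C n f)).
Proof.
apply/no_small_local_setsE; split; first exact: opL_no_small_max.
by apply: opL_no_small_min; rewrite opUN oppfK; exact: opL_no_small_max.
Qed.

Lemma no_small_local_setsN n f :
  no_small_local_sets C n f -> no_small_local_sets C n (\- f).
Proof.
by move=> /no_small_local_setsE[? ?]; apply/no_small_local_setsE; rewrite oppfK.
Qed.

Lemma opUL_no_small n f : no_small_local_sets C n (opU C n (opL C n f)).
Proof.
by rewrite opUN (opLN f) oppfK; apply/no_small_local_setsN/opLU_no_small.
Qed.

Lemma opU_id n f : no_small_max n (\- f) -> opU C n f = f.
Proof. by move=> nf; rewrite opUN opL_id // oppfK. Qed.

End Opening.

(** Constant vectors embed [nat], since a positive dimension leaves an entry to read. *)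
Lemma infinite_rV_int (d : nat) : (1 <= d)%N -> infinite_set [set: 'rV[int]_d].
Proof.
case: d => // d _; apply/infiniteP.
have inj : {in [set: nat] &, injective (fun k => const_mx k%:Z : 'rV[int]_d.+1)}.
  by move=> j k _ _ /matrixP/(_ 0 0); rewrite !mxE => -[].
rewrite -(card_le_eql (inj_card_eq inj)).
exact: subset_card_le.
Qed.

Theorem corollary13 (R : realType) (d : nat) (hd : (1 <= d)%N)
    (C : set (set 'rV[int]_d)) (hC : connection C)
    (hC1 : C setT) (hC2 : translation_invariant C)
    (hC3 : pointwise_extendable C)
    (n : nat) (hn : (1 <= n)%N) (f : 'rV[int]_d -> R) :
  (no_small_local_sets C n ((opL C n \o opU C n) f) /\
   no_small_local_sets C n ((opU C n \o opL C n) f)) /\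
  ((opL C n \o opU C n) f = (opU C n \o opL C n) f /\
   (opU C n \o opL C n) f = f
   <-> no_small_local_sets C n f).
Proof.
have infB := @infinite_rV_int d hd.
have nUL : no_small_local_sets C n (opU C n (opL C n f)) by exact: opUL_no_small.
split; first by split=> //; exact: opLU_no_small.
(* If [f] equals its image under the composite, it inherits [nUL]. *)
split=> [[_ <-]//|/no_small_local_setsE[nf nNf]] /=.
have Lf : opL C n f = f by exact: opL_id.
have Uf : opU C n f = f by exact: opU_id.
by rewrite Lf !Uf Lf.
Qed.
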